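(* Let $m$ be a positive integer and let $f\in C^3(0,\infty)$ satisfy $f(x)>0$, $f'(x)>0$, and, as $x\to\infty$, (i) $f(x)\to\infty$; (ii) $\dfrac{f'(x)}{f(x)}\to0$; (iii) $\dfrac{f''(x)/f'(x)}{f'(x)/f(x)}=O(1)$; (iv) $\dfrac{f'''(x)f(x)^2}{f'(x)^3}=O(1)$. Let $a_j=1/f(j)$, $A_N=\sum_{j=1}^Na_j$, and let $T_m(N)$ be the coupon-collector variable with coupon probabilities $p_{Nj}=a_j/A_N$, $1\le j\le N$. Put $\rho(N):=\ln\left(f(N)/f'(N)\right)$ and $$b_N=A_Nf(N)\big[\rho(N)+(m-2)\ln\rho(N)\big],\qquad k_N=A_Nf(N).$$ Then, for all $y\in\mathbb{R}$, $$P\left\{\frac{T_m(N)-b_N}{k_N}\le y\right\}\to\exp\left(-\frac{e^{-y}}{(m-1)!}\right),\qquad N\to\infty.$$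
   Context: Coupon collector setting: coupons of $N$ types are drawn independently with replacement, type $j$ having probability $p_{Nj}>0$, $\sum_{j=1}^Np_{Nj}=1$. $T_m(N)$ is the number of draws needed until every one of the $N$ types has been drawn at least $m$ times. The quantities $\rho(N)$, $b_N$ are considered for $N$ large enough that $\rho(N)>0$. *)

(* Defs.v *)
From HB Require Import structures.
From mathcomp Require Import all_boot all_order all_algebra finmap.
From mathcomp Require Import all_classical all_reals all_analysis.

Set Implicit Arguments.
Unset Strict Implicit.
Unset Printing Implicit Defensive.

Import Order.TTheory GRing.Theory Num.Theory.
Import numFieldNormedType.Exports.

Local Open Scope ring_scope.
Local Open Scope classical_set_scope.

(* Lets Landau notations be used at +oo. *)
Canonical pinfty_filter (R : numFieldType) : filter_on R :=
  FilterType (pinfty_nbhs R) _.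

(* f is of class C^k on D; meant for open D, so that the library's two-sided
   derivatives at the points of D depend only on the values of f on D. *)
Definition Ck_on (R : realType) (k : nat) (D : set R) (f : R -> R) : Prop :=
  (forall i : nat, (i < k)%N -> forall x : R, D x -> derivable (f^`(i)) x 1) /\
  (forall x : R, D x -> {for x, continuous (f^`(k))}).

Definition mutually_independent (d d' : measure_display) (T : measurableType d)
    (T' : measurableType d') (R : realType) (P : probability T R)
    (I : choiceType) (X : I -> {RV P >-> T'}) : Prop :=
  forall (J : {fset I}) (B : I -> set T'),
    (forall i, measurable (B i)) ->
    P (\bigcap_(i in [set` J]) (X i @^-1` B i)) =
      (\prod_(i <- J) P (X i @^-1` B i))%E.

(* X i is the type of the (i+1)-st coupon drawn. The N types are labelled
   1, ..., N inside nat; since the p j with 1 <= j <= N sum to 1 in every use,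
   each draw lies in 1, ..., N almost surely. *)
Definition coupon_draws (d : measure_display) (T : measurableType d)
    (R : realType) (P : probability T R) (N : nat) (p : nat -> R)
    (X : nat -> {RV P >-> nat}) : Prop :=
  mutually_independent X /\
  forall i j : nat, (1 <= j <= N)%N ->
    distribution P (X i) [set j] = (p j)%:E.

(* The least n such that each of the types 1, ..., N occurs at least m times
   among the first n draws of the outcome x; it is +oo if there is no such n. *)
Definition collection_time (R : realType) (m N : nat) (x : nat -> nat) :
    \bar R :=
  ereal_inf [set n%:R%:E | n in
    [set n : nat | forall j : nat, (1 <= j <= N)%N ->
                     (m <= count_mem j (mkseq x n))%N]].

Definition weight (R : realType) (f : R -> R) (j : nat) : R := (f j%:R)^-1.

Definition weight_sum (R : realType) (f : R -> R) (N : nat) : R :=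
  \sum_(1 <= j < N.+1) weight f j.

Definition coupon_prob (R : realType) (f : R -> R) (N j : nat) : R :=
  weight f j / weight_sum f N.

(* ln is 0 on nonpositive reals in the library, so that the quantities below
   are total; rho f N and ln (rho f N) have their usual meaning once
   rho f N > 0. *)
Definition rho (R : realType) (f : R -> R) (N : nat) : R :=
  ln (f N%:R / (f^`())%classic N%:R).

Definition centering (R : realType) (f : R -> R) (m N : nat) : R :=
  weight_sum f N * f N%:R * (rho f N + (m%:R - 2) * ln (rho f N)).

Definition scaling (R : realType) (f : R -> R) (N : nat) : R :=
  weight_sum f N * f N%:R.

(* Main.v *)
(* Let q_n be the probability that the collection is complete after n draws.
   If the number of draws is Poisson of parameter t, the counts of the types
   are independent Poisson variables, so that
   sum_n e^-t t^n/n! q_n = prod_j (1 - psi(p_j t)), where psi is the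
   probability that a Poisson variable is smaller than m.  As q_n is
   nondecreasing, Chebyshev's inequality for the Poisson law then encloses
   q_n between such products at times slightly before and after n.

   At t = s A_N f(N), p_j t = s f(N)/f(j) and the product tends to
   exp(-e^-y/(m-1)!) as soon as sum_j psi(s f(N)/f(j)) --> e^-y/(m-1)!.  For
   large s, psi(s r) is close to e^-s s^(m-1)/(m-1)! e^(-s(r-1)), and the sum
   of E(j) = e^(-s(f(N)/f(j)-1)) is equivalent to f(N)/(s f'(N)), because
   H = E f^2/(s f(N) f') satisfies H' = E (1 + O(1/s)) by condition (iii).
   Condition (iii) also bounds the derivative of f/f', so that f/f' grows at
   most linearly; hence s = O(ln N) is negligible before A_N f(N) >= N, as the
   enclosure requires. *)

Require Import Defs.
From HB Require Import structures.
From mathcomp Require Import all_boot all_order all_algebra finmap.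
From mathcomp Require Import all_classical all_reals all_analysis.
From mathcomp Require Import ring lra.

Set Implicit Arguments.
Unset Strict Implicit.
Unset Printing Implicit Defensive.

Import Order.TTheory GRing.Theory Num.Theory.
Import numFieldNormedType.Exports.

Local Open Scope ring_scope.
Local Open Scope classical_set_scope.

(** * Poissonization *)

(* [cover_prob p N n r]: the probability that, for every j, type j occurs at
   least [r j] times among n draws, by conditioning on the first draw. *)
Fixpoint cover_prob (R : realType) (p : nat -> R) (N n : nat)
    (r : nat -> nat) : R :=
  if n is n'.+1 then
    \sum_(1 <= j < N.+1) p j * cover_prob p N n' (fun i => r i - (i == j))%N
  else \prod_(1 <= j < N.+1) (r j == 0%N)%:R.

(** The exponential generating polynomial of a single type required at least [r] times; the cut-off
    [L] keeps it a polynomial. *)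
Definition exp_trunc (R : realType) (p : R) (r L : nat) : {poly R} :=
  \poly_(i < L.+1) (if (r <= i)%N then p ^+ i / i`!%:R else 0).

Definition exp_partial (R : realType) (t : R) (L : nat) : R :=
  \sum_(0 <= i < L.+1) t ^+ i / i`!%:R.

Definition poisson_lt (R : realType) (m : nat) (x : R) : R :=
  expR (- x) * \sum_(0 <= k < m) x ^+ k / k`!%:R.

Section cover_prob_theory.
Context {R : realType}.
Implicit Types (p : nat -> R) (N n m L : nat) (r : nat -> nat) (t a x : R).

(** * Monotonicity of the covering probabilities *)

Lemma cover_prob_ge0 p N n r :
  (forall j, 0 <= p j) -> 0 <= cover_prob p N n r.
Proof.
move=> p0; elim: n r => [|n IH] r /=.
  by apply: prodr_ge0 => j _; rewrite ler0n.
by apply: sumr_ge0 => j _; rewrite mulr_ge0.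
Qed.

Lemma cover_prob_anti p N n r r' : (forall j, 0 <= p j) ->
  (forall j, (r' j <= r j)%N) -> cover_prob p N n r <= cover_prob p N n r'.
Proof.
move=> p0; elim: n r r' => [|n IH] r r' rr' /=.
  apply: ler_prod => j _; rewrite ler0n ler_nat /=.
  by case: (r j) (rr' j) => [|//]; rewrite leqn0 => ->.
by apply: ler_sum => j _; rewrite ler_wpM2l// IH// => i; rewrite leq_sub2r.
Qed.

Lemma cover_prob_le1 p N n r : (forall j, 0 <= p j) ->
  \sum_(1 <= j < N.+1) p j = 1 -> cover_prob p N n r <= 1.
Proof.
move=> p0 p1; elim: n r => [|n IH] r /=.
  by apply: prodr_ile1 => j; rewrite ler0n lern1 leq_b1.
rewrite -[leRHS]p1; apply: ler_sum => j _.
by rewrite -[leRHS]mulr1 ler_wpM2l.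
Qed.

(** As the [p j] sum to 1, the value at [n] is its own average over an extra first draw, and that
    draw can only lower the requirements. *)
Lemma cover_prob_homo p N r : (forall j, 0 <= p j) ->
  \sum_(1 <= j < N.+1) p j = 1 ->
  {homo (cover_prob p N)^~ r : n n' / (n <= n')%N >-> n <= n'}.
Proof.
move=> p0 p1; apply: homo_leq => [//|y x z|n]; first exact: le_trans.
rewrite -[leLHS]mul1r -p1 mulr_suml; apply: ler_sum => j _.
by rewrite ler_wpM2l// cover_prob_anti// => i; rewrite leq_subr.
Qed.

(** * Exponential generating polynomials of the covering probabilities *)

Lemma coef_exp_trunc (q : R) k L i : (exp_trunc q k L)`_i =
  if (k <= i <= L)%N then q ^+ i / i`!%:R else 0.
Proof. by rewrite coef_poly ltnS andbC; case: ifP. Qed.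

(** Truncated subtraction is right at [k = 0], but not at [L = 0]: there the derivative vanishes
    while the right-hand side is [q] for [k <= 1]. *)
Lemma deriv_exp_trunc (q : R) k L : (0 < L)%N ->
  deriv (exp_trunc q k L) = q *: exp_trunc q (k - 1) (L - 1).
Proof.
case: L => // L _; apply/polyP => i.
rewrite coef_deriv coefZ !coef_exp_trunc leq_subLR add1n subSS subn0 ltnS.
case: ifP => _; last by rewrite mulr0 mul0rn.
have i0 : i.+1%:R != 0 :> R by rewrite pnatr_eq0.
have f0 : i`!%:R != 0 :> R by rewrite pnatr_eq0 -lt0n fact_gt0.
rewrite exprS factS natrM -[LHS]mulr_natr.
move: i.+1%:R i`!%:R i0 f0 => a b a0 b0; field.
by rewrite a0 b0.
Qed.

(** The degree bounds [l] depend on the type because differentiating one factor lowers the bound of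
    that factor alone. *)
Definition cover_poly p N r (l : nat -> nat) : {poly R} :=
  \prod_(1 <= j < N.+1) exp_trunc (p j) (r j) (l j).

(* The polynomial counterpart of conditioning on the first draw. *)
Lemma deriv_cover_poly p N r (l : nat -> nat) : (forall j, (0 < l j)%N) ->
  deriv (cover_poly p N r l) = \sum_(1 <= j < N.+1) p j *:
   cover_poly p N (fun i => r i - (i == j))%N (fun i => l i - (i == j))%N.
Proof.
move=> l0; elim: N => [|N IH]; first by rewrite /cover_poly !big_nil derivC.
rewrite {1}/cover_poly big_nat_recr//= derivM [X in deriv X * _]/= IH.
rewrite [RHS]big_nat_recr//= deriv_exp_trunc//; congr +%R.
  rewrite mulr_suml; apply: eq_big_nat => j /andP[_ jN].
  rewrite -scalerAl; congr (_ *: _).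
  by rewrite [in RHS]/cover_poly big_nat_recr//= gtn_eqF// !subn0.
rewrite -scalerAr; congr (_ *: _).
rewrite /cover_poly [in RHS]big_nat_recr//= eqxx; congr (_ * _).
by apply: eq_big_nat => j /andP[_ jN]; rewrite ltn_eqF// !subn0.
Qed.

(** Comparing coefficients in [deriv_cover_poly] gives the recursion of [cover_prob]. Each
    derivative lowers [n] by one and every bound by at most one, so the truncation is never felt. *)
Lemma coef_cover_poly p N n r (l : nat -> nat) : (forall j, (n <= l j)%N) ->
  (cover_poly p N r l)`_n * n`!%:R = cover_prob p N n r.
Proof.
elim: n r l => [|n IH] r l nl /=.
  rewrite fact0 mulr1 -horner_coef0 horner_prod; apply: eq_bigr => j _.
  rewrite horner_coef0 coef_exp_trunc leq0n andbT leqn0 fact0 divr1 expr0.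
  by case: (r j == 0%N).
have := congr1 (fun q : {poly R} => q`_n) (@deriv_cover_poly p N r l (fun j =>
  leq_trans (ltn0Sn _) (nl j))).
rewrite coef_deriv coef_sum => E.
rewrite factS natrM mulrA [_`_n.+1 * _]mulr_natr E mulr_suml.
apply: eq_bigr => j _; rewrite coefZ -mulrA IH// => i.
by rewrite leq_subRL ?(leq_trans _ (nl i))//; case: (i == j); rewrite
  ?(leq_trans _ (nl i))// add0n (leq_trans _ (nl i)).
Qed.

Lemma coef_prod_homo (I : Type) (s : seq I) (F G : I -> {poly R}) i :
  (forall k i, 0 <= (F k)`_i <= (G k)`_i) ->
  0 <= (\prod_(k <- s) F k)`_i <= (\prod_(k <- s) G k)`_i.
Proof.
move=> FG; elim: s i => [|k s IH] i; first by rewrite !big_nil coef1 ler0n lexx.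
rewrite !big_cons !coefM; apply/andP; split.
  apply: sumr_ge0 => j _; apply: mulr_ge0; first by case/andP: (FG k j).
  by case/andP: (IH (i - j)%N).
apply: ler_sum => j _; case/andP: (FG k j) => F0 FG1.
by case/andP: (IH (i - j)%N) => H0 H1; exact: ler_pM.
Qed.

(** * Truncated Poisson sums and Chebyshev's inequality *)

Lemma exp_partial_le t L : 0 <= t -> exp_partial t L <= expR t.
Proof.
move=> t0; rewrite /exp_partial.
have := @nondecreasing_cvgn_le R (series (exp_coeff t)) _
  (is_cvg_series_exp_coeff t) L.+1.
apply; apply: nondecreasing_series => // i _ _.
exact: exp_coeff_ge0.
Qed.

Lemma exp_partial_cvg t : exp_partial t L @[L --> \oo] --> expR t.
Proof.
have h : series (exp_coeff t) @ \oo --> expR t.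
  exact: is_cvg_series_exp_coeff.
by rewrite -(cvg_shiftS (series (exp_coeff t))) in h.
Qed.

(** The Poisson variance equals its mean; cutting the series at [L] leaves a boundary term, which is
    nonpositive once [t <= L.+1]. *)
Lemma poisson_variance t L :
  \sum_(0 <= n < L.+1) t ^+ n / n`!%:R * (n%:R - t) ^+ 2 =
  t * exp_partial t L + t * (t ^+ L / L`!%:R) * (t - L%:R - 1).
Proof.
rewrite /exp_partial; elim: L => [|L IH].
  by rewrite !big_nat1 fact0 expr0; ring.
rewrite big_nat_recr//= IH [in RHS]big_nat_recr//= mulrDr.
(* Expressed through the summand of index [L.+1], the old boundary term can be combined with the new
   ones. *)
have -> : t * (t ^+ L / L`!%:R) = L.+1%:R * (t ^+ L.+1 / L.+1`!%:R).
  have i0 : L.+1%:R != 0 :> R by rewrite pnatr_eq0.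
  have f0 : L`!%:R != 0 :> R by rewrite pnatr_eq0 -lt0n fact_gt0.
  rewrite exprS factS natrM.
  move: L.+1%:R L`!%:R i0 f0 => a b a0 b0; field.
  by rewrite a0 b0.
by rewrite -(natr1 L); ring.
Qed.

Lemma poisson_variance_le t L : 0 <= t -> t <= L.+1%:R ->
  \sum_(0 <= n < L.+1) t ^+ n / n`!%:R * (n%:R - t) ^+ 2 <= t * exp_partial t L.
Proof.
move=> t0 tL; rewrite poisson_variance gerDl mulr_ge0_le0//.
  by rewrite mulr_ge0// divr_ge0// exprn_ge0.
by rewrite -addrA -opprD natr1 subr_le0.
Qed.

Lemma horner_exp_trunc (q t : R) k L : (k <= L)%N ->
  (exp_trunc q k L).[t] =
  exp_partial (q * t) L - \sum_(0 <= i < k) (q * t) ^+ i / i`!%:R.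
Proof.
move=> kL; rewrite /exp_partial (@big_cat_nat _ _ _ k)//=; last exact: ltnW.
rewrite addrAC subrr add0r /exp_trunc horner_poly.
rewrite -(big_mkord xpredT (fun i => (if (k <= i)%N then q ^+ i / i`!%:R else 0)
  * t ^+ i)).
rewrite (@big_cat_nat _ _ _ k)//=; last exact: ltnW.
rewrite big_nat_cond big1 ?add0r; last first.
  by move=> i; rewrite andbT /= => ik; rewrite leqNgt ik mul0r.
by apply: eq_big_nat => i /andP[-> _]; rewrite exprMn mulrAC.
Qed.

(** Markov's inequality for the squared deviation, with the factor e^-t cleared and the series cut
    at [L]. *)
Lemma poisson_chebyshev t a L : 0 <= t -> 0 < a -> t <= L.+1%:R ->
  \sum_(0 <= i < L.+1 | a <= `|i%:R - t|) t ^+ i / i`!%:R <=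
  t / a ^+ 2 * exp_partial t L.
Proof.
move=> t0 a0 tL; rewrite mulrAC ler_pdivlMr ?exprn_gt0//.
apply: le_trans (poisson_variance_le t0 tL).
have u0 i : 0 <= t ^+ i / i`!%:R by rewrite divr_ge0// exprn_ge0.
rewrite mulr_suml [leRHS](bigID (fun i => a <= `|i%:R - t|))/=.
rewrite -[leLHS]addr0 lerD//.
  apply: ler_sum => i ai; rewrite ler_wpM2l// -[leRHS]real_normK ?num_real//.
  by rewrite lerXn2r// ?nnegrE// ltW.
by apply: sumr_ge0 => i _; rewrite mulr_ge0// sqr_ge0.
Qed.

(* With a Poisson number of draws the counts of the types are independent,
   hence the product; the truncation at L makes this an identity between
   polynomials, at the price of an inequality. *)
Lemma poisson_mixture_le p N r t L : 0 <= t -> (forall j, 0 <= p j) ->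
  \sum_(0 <= i < L.+1) cover_prob p N i r * (t ^+ i / i`!%:R) <=
  (cover_poly p N r (fun=> L)).[t].
Proof.
move=> t0 p0; set F := cover_poly _ _ _ _.
have F0 i : 0 <= F`_i.
  have := @coef_prod_homo _ (index_iota 1 N.+1) (fun j => exp_trunc (p j) (r j)
    L) (fun j => exp_trunc (p j) (r j) L) i.
  case/(_ _)/andP => // k {}i; rewrite lexx andbT coef_exp_trunc.
  by case: ifP => // _; rewrite divr_ge0// exprn_ge0.
rewrite (@horner_coef_wide _ (maxn (size F) L.+1)) ?leq_maxl//.
rewrite -(big_mkord xpredT (fun i => F`_i * t ^+ i)).
rewrite [leRHS](@big_cat_nat _ _ _ L.+1)//= ?leq_maxr//.
rewrite -[leLHS]addr0 lerD//; last first.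
  by apply: sumr_ge0 => i _; rewrite mulr_ge0// exprn_ge0.
rewrite le_eqVlt; apply/orP; left; apply/eqP.
apply: eq_big_nat => i /andP[_ iL].
rewrite -(@coef_cover_poly p N i r (fun=> L))// -/F.
by rewrite mulrCA -mulrA mulfV ?mulr1 1?mulrC// pnatr_eq0 -lt0n fact_gt0.
Qed.

(** Raising the degree bounds from [L] to [M] can only increase the coefficients, and up to degree
    [M] they then are exactly the covering probabilities divided by factorials. *)
Lemma poisson_mixture_ge p N r t L : 0 <= t -> (forall j, 0 <= p j) ->
  exists M, (cover_poly p N r (fun=> L)).[t] <=
    \sum_(0 <= i < M.+1) cover_prob p N i r * (t ^+ i / i`!%:R) /\
    t <= M.+1%:R.
Proof.
move=> t0 p0; set F := cover_poly _ _ _ _.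
(* [M] exceeds the degree of [F], is at least [L], and gives the condition [t <= M.+1] of
   [poisson_chebyshev]. *)
pose M := maxn (maxn (size F) L) (Num.truncn t); exists M; split; last first.
  rewrite ltW// (lt_le_trans (truncnS_gt t))// ler_nat ltnS /M.
  exact: leq_maxr.
rewrite (@horner_coef_wide _ M.+1); last first.
  by rewrite ltnW// ltnS /M !leq_max leqnn.
rewrite -(big_mkord xpredT (fun i => F`_i * t ^+ i)).
apply: ler_sum_nat => i /andP[_ iM].
rewrite -(@coef_cover_poly p N i r (fun=> M))//.
rewrite mulrCA -mulrA mulfV ?mulr1; last by rewrite pnatr_eq0 -lt0n fact_gt0.
rewrite mulrC ler_wpM2l ?exprn_ge0//.
case/(_ _)/andP: (@coef_prod_homo _ (index_iota 1 N.+1) (fun j => exp_trunc (p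
  j) (r j) L) (fun j => exp_trunc (p j) (r j) M) i) => // j k.
rewrite !coef_exp_trunc; case: (leqP (r j) k) => //= _; last by rewrite lexx.
have u0 : 0 <= p j ^+ k / k`!%:R by rewrite divr_ge0// exprn_ge0.
case: (leqP k L) => [kL|_]; last by case: ifP; rewrite ?lexx.
by rewrite (leq_trans kL) ?u0 ?lexx// /M !leq_max leqnn orbT.
Qed.

(** * Enclosure of the covering probabilities between Poisson products *)

Lemma poisson_lt_prod p N m t : \sum_(1 <= j < N.+1) p j = 1 ->
  expR t * \prod_(1 <= j < N.+1) (1 - poisson_lt m (p j * t)) =
  \prod_(1 <= j < N.+1)
    (expR (p j * t) - \sum_(0 <= i < m) (p j * t) ^+ i / i`!%:R).
Proof.
move=> p1; have -> : expR t = \prod_(1 <= j < N.+1) expR (p j * t).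
  by rewrite -expR_sum -mulr_suml p1 mul1r.
rewrite -big_split/=; apply: eq_bigr => j _; rewrite mulrBr mulr1 /poisson_lt mulrA.
by rewrite -expRD subrr expR0 mul1r.
Qed.

(** With probability at least 1 - t/a^2 a Poisson number of draws exceeds [t - a], hence [n], and
    covering is then at least as likely as after [n] draws. The truncated sums are compared first;
    then [L] tends to infinity. *)
Lemma cover_prob_le_poisson p N m t a n : (forall j, 0 <= p j) ->
  \sum_(1 <= j < N.+1) p j = 1 -> 0 <= t -> 0 < a -> n%:R <= t - a ->
  cover_prob p N n (fun=> m) * (1 - t / a ^+ 2) <=
  \prod_(1 <= j < N.+1) (1 - poisson_lt m (p j * t)).
Proof.
move=> p0 p1 t0 a0 nta; rewrite -(ler_pM2l (expR_gt0 t)) poisson_lt_prod//.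
set c := cover_prob _ _ _ _; set Q := leRHS.
rewrite mulrC.
have cvL : c * (1 - t / a ^+ 2) * exp_partial t L @[L --> \oo] -->
    c * (1 - t / a ^+ 2) * expR t.
  by apply: cvgMr; exact: exp_partial_cvg.
apply: (@cvgr_to_le _ _ _ _ (fun L => c * (1 - t / a ^+ 2) * exp_partial t L) _
  _ cvL).
near=> L.
have mL : (m <= L)%N by near: L; exact: nbhs_infty_ge.
have tL : t <= L.+1%:R.
  rewrite (@le_trans _ _ L%:R) ?ler_nat//.
  by near: L; exact: nbhs_infty_ger.
have c0 : 0 <= c by exact: cover_prob_ge0.
apply: (@le_trans _ _ ((cover_poly p N (fun=> m) (fun=> L)).[t])); last first.
  rewrite horner_prod; apply: ler_prod => j _.
  rewrite horner_exp_trunc// lerD2r exp_partial_le ?mulr_ge0// andbT.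
  rewrite /exp_partial (@big_cat_nat _ _ _ m)//= ?leqW// addrAC subrr add0r.
  by apply: sumr_ge0 => i _; rewrite divr_ge0// exprn_ge0// mulr_ge0.
apply: le_trans (poisson_mixture_le _ _ _ _ _) => //.
have u0 i : 0 <= t ^+ i / i`!%:R by rewrite divr_ge0// exprn_ge0.
(* Indices at distance at least [a] from [t] are discarded; the others exceed [n], so monotonicity
   bounds their coefficient below by [c]. *)
rewrite [leRHS](bigID (fun i => a <= `|i%:R - t|))/=.
rewrite -[leLHS]add0r lerD//.
  by apply: sumr_ge0 => i _; rewrite mulr_ge0// cover_prob_ge0.
apply: (@le_trans _ _ (\sum_(0 <= i < L.+1 | ~~ (a <= `|i%:R - t|)) c * (t ^+ i
  / i`!%:R))); last first.
  apply: ler_sum => i; rewrite -ltNge ltr_norml => /andP[ai _].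
  rewrite ler_wpM2r// cover_prob_homo// -(ler_nat R).
  by rewrite (le_trans nta)//; lra.
rewrite -mulr_sumr -mulrA ler_wpM2l//.
have := poisson_chebyshev t0 a0 tL.
have -> : exp_partial t L = \sum_(0 <= i < L.+1 | a <= `|i%:R - t|) t ^+ i /
  i`!%:R + \sum_(0 <= i < L.+1 | ~~ (a <= `|i%:R - t|)) t ^+ i / i`!%:R.
  by rewrite /exp_partial (bigID (fun i => a <= `|i%:R - t|)).
rewrite [t / _ * _]mulrC mulrC => h; nra.
Unshelve. all: by end_near.
Qed.

(** A number of draws within [a] of [t] is below [n.+1], hence at most [n]; the others are
    controlled by Chebyshev and the bound 1. The form [n.+1] suits an [n] that is the integer part
    of a real. *)
Lemma poisson_le_cover_prob p N m t a n : (forall j, 0 <= p j) ->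
  \sum_(1 <= j < N.+1) p j = 1 -> 0 <= t -> 0 < a -> t + a <= n.+1%:R ->
  \prod_(1 <= j < N.+1) (1 - poisson_lt m (p j * t)) <=
  cover_prob p N n (fun=> m) + t / a ^+ 2.
Proof.
move=> p0 p1 t0 a0 nta; rewrite -(ler_pM2l (expR_gt0 t)) poisson_lt_prod//.
set c := cover_prob _ _ _ _; set Q := leRHS.
have cvL : \prod_(1 <= j < N.+1) (exp_partial (p j * t) L -
      \sum_(0 <= i < m) (p j * t) ^+ i / i`!%:R) @[L --> \oo] -->
    \prod_(1 <= j < N.+1) (expR (p j * t) -
      \sum_(0 <= i < m) (p j * t) ^+ i / i`!%:R).
  apply: cvg_big => [|j _]; first exact: mul_continuous.
  by apply: cvgB; [exact: exp_partial_cvg|exact: cvg_cst].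
apply: (@cvgr_to_le _ _ _ _ (fun L => \prod_(1 <= j < N.+1) (exp_partial (p j *
  t) L -
      \sum_(0 <= i < m) (p j * t) ^+ i / i`!%:R)) _ _ cvL).
near=> L.
have mL : (m <= L)%N by near: L; exact: nbhs_infty_ge.
have c0 : 0 <= c by exact: cover_prob_ge0.
have u0 i : 0 <= t ^+ i / i`!%:R by rewrite divr_ge0// exprn_ge0.
apply: (@le_trans _ _ ((cover_poly p N (fun=> m) (fun=> L)).[t])).
  rewrite horner_prod le_eqVlt; apply/orP; left; apply/eqP.
  by apply: eq_bigr => j _; rewrite horner_exp_trunc.
have [M [/le_trans + tM]] := poisson_mixture_ge N (fun=> m) L t0 p0; apply.
apply: (@le_trans _ _ (exp_partial t M * (c + t / a ^+ 2))); last first.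
  by rewrite ler_wpM2r ?exp_partial_le// addr_ge0// divr_ge0// exprn_ge0// ltW.
rewrite (bigID (fun i => a <= `|i%:R - t|))/= mulrDr addrC lerD//; last first.
  rewrite mulrC; apply: le_trans (poisson_chebyshev t0 a0 tM).
  by apply: ler_sum => i _; rewrite -[leRHS]mul1r ler_wpM2r// cover_prob_le1.
rewrite mulr_suml /exp_partial [leRHS](bigID (fun i => a <= `|i%:R - t|))/=.
rewrite -[leLHS]add0r lerD//.
  by apply: sumr_ge0 => i _; rewrite mulr_ge0.
apply: ler_sum => i; rewrite -ltNge ltr_norml => /andP[_ ai].
rewrite mulrC ler_wpM2l// cover_prob_homo// -ltnS -(ltr_nat R).
by rewrite (lt_le_trans _ nta)//; lra.
Unshelve. all: by end_near.
Qed.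

End cover_prob_theory.

(** * The law of the draws *)

Section coupon_law.
Context (d : measure_display) (T : measurableType d) (R : realType)
  (P : probability T R).
Implicit Types (X : nat -> {RV P >-> nat}) (p : nat -> R).

(** Splitting on the value of the first draw gives a countable union; the induction applies to its
    pieces because [A] is arbitrary. *)
Lemma measurable_word X (s : seq nat) (A : set (seq nat)) :
  measurable [set x | A [seq X i x | i <- s]].
Proof.
elim: s A => [|i s IH] A /=.
  have [A0|A0] := pselect (A [::]).
    by rewrite (_ : [set _ | _] = setT)//; apply/seteqP; split.
  by rewrite (_ : [set _ | _] = set0)//; apply/seteqP; split.
rewrite (_ : [set _ | _] = \bigcup_k (X i @^-1` [set k] `&`
    [set x | A (k :: [seq X j x | j <- s])])).
  apply: bigcupT_measurable => k; apply: measurableI; last first.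
    exact: (IH (fun l => A (k :: l))).
  by rewrite -[_ @^-1` _]setTI; exact: measurable_funP.
apply/seteqP; split => [x Ax|x [k _ [<-]]//].
by exists (X i x).
Qed.

(** The values 1, ..., N carry total mass 1, so the event that [Y] takes another value is null. *)
Lemma measure_split_draw (Y : {RV P >-> nat}) p N (A : set T) :
  (forall j, (1 <= j <= N)%N -> distribution P Y [set j] = (p j)%:E) ->
  \sum_(1 <= j < N.+1) p j = 1 -> measurable A ->
  P A = (\sum_(1 <= j < N.+1) P (A `&` Y @^-1` [set j]))%E.
Proof.
move=> Yp p1 mA.
have mY j : measurable (Y @^-1` [set j]).
  by rewrite -[_ @^-1` _]setTI; exact: measurable_funP.
pose U := \big[setU/set0]_(i < N) (Y @^-1` [set i.+1]).
have mU : measurable U by exact: bigsetU_measurable.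
have tU (B : nat -> set T) : trivIset setT (fun i : 'I_N => B i.+1 `&` Y @^-1`
  [set i.+1]).
  apply/trivIsetP => i j _ _ ij; apply/seteqP; split => // x [[_ /= ->] [_
    [/ord_inj ji]]].
  by rewrite ji eqxx in ij.
have PU : P U = 1%E.
  rewrite measure_bigsetU_ord//; last first.
    by have := tU (fun=> setT); under eq_fun do rewrite setTI.
  rewrite (eq_bigr (fun i : 'I_N => (p i.+1)%:E)); last first.
    by move=> i _; apply: Yp; rewrite /= ltn_ord.
  by rewrite sumEFin -p1 big_add1 big_mkord.
have PCU : P (~` U) = 0%E by rewrite probability_setC// PU subee.
have PUC : P (A `\` U) = 0%E.
  apply: (@subset_measure0 _ _ _ P _ (~` U)).
  - exact: measurableD.
  - exact: measurableC.
  - by move=> x [].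
  - exact: PCU.
have PA : P A = P (A `&` U).
  by have := measureDI P mA mU; rewrite [X in _ = X + _ -> _]PUC add0e.
rewrite PA /U big_distrr/= measure_bigsetU_ord//; last first.
- by have := tU (fun=> A).
- by move=> i; exact: measurableI.
by rewrite big_add1 big_mkord.
Qed.

Lemma prob_word X p N (w : seq nat) : coupon_draws N p X ->
  all (fun j => 1 <= j <= N)%N w ->
  P [set x | [seq X i x | i <- iota 0 (size w)] = w] = (\prod_(j <- w) p j)%:E.
Proof.
move=> [indep Xp] wN.
(* Independence of the first [size w] draws, each prescribed to be the letter of [w] at its
   position. *)
have := indep [fset i | i in iota 0 (size w)]%fset (fun i => [set nth 0%N w i])
  (fun=> I).
rewrite (_ : \bigcap_(i in _) _ = [set x | [seq X i x | i <- iota 0 (size w)] = w]).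
  move=> ->; rewrite (perm_big (iota 0 (size w)))/=; last first.
    apply: uniq_perm; rewrite ?fset_uniq ?iota_uniq// => i.
    by rewrite !inE/=.
  rewrite -[in RHS](mkseq_nth 0%N w) big_map -prodEFin.
  rewrite big_seq [in RHS]big_seq; apply: eq_bigr => i; rewrite mem_iota => /= iw.
  by apply: Xp; exact/(all_nthP _ wN).
apply/seteqP; split => x /= h.
  apply: (@eq_from_nth _ 0%N); rewrite size_map size_iota// => i iw.
  rewrite (nth_map 0%N) ?size_iota// nth_iota// add0n.
  by apply: (h i); rewrite /= !inE mem_iota.
move=> i /=; rewrite !inE mem_iota/= add0n => iw.
by rewrite -[in RHS]h (nth_map 0%N) ?size_iota// nth_iota.
Qed.

(** [w] records the draws already made. The next draw is appended to [w] and lowers [r], as in the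
    recursion of [cover_prob]; joint events replace conditional probabilities. *)
Lemma cover_prob_cond X p N n (w : seq nat) (r : nat -> nat) :
  coupon_draws N p X -> \sum_(1 <= j < N.+1) p j = 1 ->
  all (fun j => 1 <= j <= N)%N w ->
  P [set x | [seq X i x | i <- iota 0 (size w)] = w /\
     forall j, (1 <= j <= N)%N ->
       (r j <= count_mem j [seq X i x | i <- iota (size w) n])%N] =
  ((\prod_(j <- w) p j) * cover_prob p N n r)%:E.
Proof.
move=> Xp p1; elim: n w r => [|n IH] w r wN /=.
  have [r0|] := pselect (forall j, (1 <= j <= N)%N -> r j = 0%N).
    have -> : \prod_(1 <= j < N.+1) (r j == 0%N)%:R = 1 :> R.
      by rewrite big_nat_cond big1// => i; rewrite andbT => /r0 ->.
    rewrite mulr1 -(prob_word Xp wN); congr (P _).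
    by apply/seteqP; split => x /=; [case|split=> // j /r0 ->].
  move=> /existsNP[j /not_implyP[jN /eqP rj]].
  rewrite (_ : [set _ | _] = set0); last first.
    apply/seteqP; split => x //= -[_ /(_ j jN)].
    by rewrite leqn0 (negbTE rj).
  rewrite measure0 [X in _ * X](bigD1_seq j)/= ?mem_index_iota ?iota_uniq//.
  by rewrite (negbTE rj) mul0r mulr0.
set E := [set _ | _].
have mE : measurable E.
  apply: (@measurableI _ _ [set x | [seq X i x | i <- iota 0 (size w)] = w]).
    exact: (measurable_word X (iota 0 (size w)) (fun l => l = w)).
  exact: (measurable_word X (iota (size w) n.+1) (fun l => forall j,
    (1 <= j <= N)%N -> (r j <= count_mem j l)%N)).
case: (Xp) => _ Xm.
rewrite (measure_split_draw (Xm (size w)) p1 mE) mulr_sumr -sumEFin.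
apply: eq_big_nat => j jN.
rewrite mulrA (_ : \prod_(i <- w) p i * p j = \prod_(i <- rcons w j) p i); last
  first.
  by rewrite -cats1 big_cat/= big_seq1.
rewrite -IH; last by rewrite all_rcons jN.
congr (P _); apply/seteqP; rewrite size_rcons -addn1 iotaD/=; split => x /=.
  move=> [[wx rx] xj]; split; first by rewrite map_cat wx/= add0n xj cats1.
  move=> i /rx; rewrite xj leq_subLR.
  by rewrite [i == j]eq_sym addn1.
rewrite map_cat cats1 add0n => -[] /rcons_inj[wx xj] rx; split => //; split=> //
  i /rx.
by rewrite leq_subLR xj eq_sym addn1.
Qed.

End coupon_law.

Lemma coupon_cover_prob (d : measure_display) (T : measurableType d)
  (R : realType) (P : probability T R) (X : nat -> {RV P >-> nat})
  (p : nat -> R) (N n m : nat) :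
  coupon_draws N p X -> \sum_(1 <= j < N.+1) p j = 1 ->
  P [set x | forall j, (1 <= j <= N)%N ->
       (m <= count_mem j (mkseq (fun i => X i x) n))%N] =
  (cover_prob p N n (fun=> m))%:E.
Proof.
move=> Xp p1; have := cover_prob_cond n (fun=> m) Xp p1 (isT : all _ [::]).
rewrite big_nil mul1r => <-; congr (P _).
by apply/seteqP; split => x /=; [split|case].
Qed.

(** Completeness persists under further draws, so only the integer part of [u] matters. If the
    collection is incomplete then, the infimum is at least [(Num.truncn u).+1], also when it is
    [+oo]. *)
Lemma collection_time_le (R : realType) (m N : nat) (x : nat -> nat) (u : R) :
  0 <= u ->
  (collection_time R m N x <= u%:E)%E <->
  forall j, (1 <= j <= N)%N -> (m <= count_mem j (mkseq x (Num.truncn u)))%N.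
Proof.
move=> u0; split => [xu|H]; last first.
  apply: (@le_trans _ _ (Num.truncn u)%:R%:E); last by rewrite lee_fin truncn_le.
  by apply: ereal_inf_lbound; exists (Num.truncn u).
apply: contrapT => /existsNP[j /not_implyP[jN /negP xj]].
have : ((Num.truncn u).+1%:R%:E <= collection_time R m N x)%E.
  apply: le_ereal_inf_tmp => _ [n /= Hn <-]; rewrite lee_fin ler_nat ltnNge.
  apply: contra xj => nu; apply: leq_trans (Hn j jN) _.
  rewrite /mkseq -(subnKC nu) iotaD map_cat count_cat; exact: leq_addr.
move=> /le_trans/(_ xu); rewrite lee_fin leNgt => /negP; apply.
exact: truncnS_gt.
Qed.

(** * Asymptotics *)

Section riemann_sum.
Context {R : realType}.
Variables (f f1 f2 : R -> R) (K : R) (J : nat).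
Hypothesis f_gt0 : forall x : R, 0 < x -> 0 < f x.
Hypothesis f1_gt0 : forall x : R, 0 < x -> 0 < f1 x.
Hypothesis df : forall x : R, 0 < x -> is_derive x (1 : R) f (f1 x).
Hypothesis df1 : forall x : R, 0 < x -> is_derive x (1 : R) f1 (f2 x).
Hypothesis J_gt0 : (0 < J)%N.
Hypothesis f2_le : forall x : R, J%:R <= x -> `|f2 x * f x / f1 x ^+ 2| <= K.

Let derive_continuous_within (h h' : R -> R) (a b : R) :
  (forall x : R, a <= x -> is_derive x (1 : R) h (h' x)) ->
  {within `[a, b], continuous h}.
Proof.
move=> dh; apply: derivable_within_continuous => x.
by rewrite in_itv/= => /andP[/dh[]].
Qed.

Lemma pos_derive_homo x y : 0 < x -> x <= y -> f x <= f y.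
Proof.
move=> x0 xy.
have [c cxy E] : exists2 c, c \in `[x, y]%R & f y - f x = f1 c * (y - x).
  apply: MVT_segment => // [z|].
    by rewrite in_itv/= => /andP[/(lt_trans x0)/df].
  by apply: derive_continuous_within => z /(lt_le_trans x0)/df.
rewrite -subr_ge0 E mulr_ge0 ?subr_ge0// ltW// f1_gt0//.
by move: cxy; rewrite in_itv/= => /andP[/(lt_le_trans x0)].
Qed.

(** The derivative 1 - f2 f/f1^2 of f/f1 is at most [K + 1] beyond [J], and the mean value theorem
    applies. *)
Lemma ratio_sublinear N : (J <= N)%N ->
  f N%:R / f1 N%:R <= f J%:R / f1 J%:R + (K + 1) * N%:R.
Proof.
move=> JN; pose g' (x : R) := 1 - f2 x * f x / f1 x ^+ 2.
have J0 : 0 < J%:R :> R by rewrite ltr0n.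
have dg (x : R) : J%:R <= x -> is_derive x (1 : R) (fun x => f x / f1 x) (g' x).
  move=> /(lt_le_trans J0) x0.
  have f1x : f1 x != 0 by rewrite gt_eqF// f1_gt0.
  have d1 := df x0; have d2 := df1 x0.
  have dv : is_derive x (1 : R) (fun y => (f1 y)^-1) (- (f1 x) ^- 2 *: f2 x).
    exact: is_deriveV.
  apply: (is_derive_eq (is_deriveM d1 dv)).
  by rewrite /g' /GRing.scale/=; field.
have [c cxy E] : exists2 c, c \in `[J%:R, N%:R]%R &
    f N%:R / f1 N%:R - f J%:R / f1 J%:R = g' c * (N%:R - J%:R).
  apply: (@MVT_segment _ (fun x => f x / f1 x)) => // [|z|].
  - by rewrite ler_nat.
  - by rewrite in_itv/= => /andP[/ltW/dg].
  - exact: derive_continuous_within dg.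
rewrite -lerBlDl E.
have /f2_le : J%:R <= c by move: cxy; rewrite in_itv/= => /andP[].
rewrite ler_norml => /andP[h1 h2].
have N0 : 0 <= N%:R - J%:R :> R by rewrite subr_ge0 ler_nat.
apply: (@le_trans _ _ ((K + 1) * (N%:R - J%:R))).
  by rewrite ler_wpM2r// /g'; lra.
by rewrite ler_wpM2l//; lra.
Qed.

Variables (N : nat) (s : R).
Hypothesis JN : (J <= N)%N.
Hypothesis s_gt0 : 0 < s.

(* [H] is an approximate primitive of [E]: [H' = E * (1 + O(1/s))] because
   [f2 * f / f1 ^+ 2] is bounded. *)
Let E (x : R) := expR (- (s * (f N%:R / f x - 1))).
Let H (x : R) := E x * (f x ^+ 2 / f1 x / (f N%:R * s)).
Let H' (x : R) := E x * (1 + f x / (f N%:R * s) * (2 - f2 x * f x / f1 x ^+ 2)).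
Let J0 : 0 < J%:R :> R. Proof. by rewrite ltr0n. Qed.
Let N0 : 0 < N%:R :> R. Proof. by rewrite ltr0n (leq_trans J_gt0). Qed.

Let dH (x : R) : 0 < x -> is_derive x (1 : R) H (H' x).
Proof.
move=> x0.
have f1x : f1 x != 0 by rewrite gt_eqF// f1_gt0.
have fx : f x != 0 by rewrite gt_eqF// f_gt0.
have fN : f N%:R != 0 by rewrite gt_eqF// f_gt0.
have s0 : s != 0 by rewrite gt_eqF.
have d1 := df x0; have d2 := df1 x0.
have dv : is_derive x (1 : R) (fun y => (f y)^-1) (- (f x) ^- 2 *: f1 x).
  exact: is_deriveV.
have dv1 : is_derive x (1 : R) (fun y => (f1 y)^-1) (- (f1 x) ^- 2 *: f2 x).
  exact: is_deriveV.
have dI : is_derive x (1 : R) (fun y => - (s * (f N%:R / f y - 1)))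
    (s * f N%:R * f1 x / f x ^+ 2).
  have := is_deriveN (is_deriveZ s (is_deriveB (is_deriveZ (f N%:R) dv)
    (is_derive_cst (1 : R) x (1 : R)))).
  move=> h; apply: (is_derive_eq h).
  by rewrite /GRing.scale/=; field.
have dE : is_derive x (1 : R) E (E x * (s * f N%:R * f1 x / f x ^+ 2)).
  exact: (is_derive1_comp (is_derive_expR _) dI).
have dG : is_derive x (1 : R) (fun y => f y ^+ 2 / f1 y / (f N%:R * s))
    ((2 * f x - f x ^+ 2 * f2 x / f1 x ^+ 2) / (f N%:R * s)).
  have := is_deriveZ (f N%:R * s)^-1 (is_deriveM (is_deriveX 2 d1) dv1).
  rewrite (_ : _ \*: _ = (fun y => f y ^+ 2 / f1 y / (f N%:R * s))); last first.
    by apply/funext => y /=; rewrite /GRing.scale/= mulrC.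
  move=> h; apply: (is_derive_eq h).
  rewrite /GRing.scale/= exprfctE /=; field.
  by rewrite fN s0 f1x.
apply: (is_derive_eq (is_deriveM dE dG)).
rewrite /H' /GRing.scale/=; field.
by rewrite s0 fN fx f1x.
Qed.

(** [C] bounds |2 - f2 f/f1^2|; since f x <= f N for x <= N, the relative error in [H'] is then at
    most [C / s]. *)
Let C := K + 2.

Let H'_bound (x : R) : J%:R <= x -> x <= N%:R ->
  E x * (1 - C / s) <= H' x <= E x * (1 + C / s).
Proof.
move=> Jx xN; have x0 : 0 < x by exact: lt_le_trans Jx.
have := f2_le Jx; rewrite ler_norml => /andP[h1 h2].
have E0 : 0 <= E x by exact: expR_ge0.
suff : `|f x / (f N%:R * s) * (2 - f2 x * f x / f1 x ^+ 2)| <= C / s.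
  by rewrite ler_norml => /andP[k1 k2]; rewrite /H' !ler_wpM2l//; lra.
have fxN : 0 <= f x / (f N%:R * s) <= s^-1.
  apply/andP; split.
    by rewrite divr_ge0 ?(ltW (f_gt0 x0))// mulr_ge0 ?(ltW s_gt0)// ltW// f_gt0.
  rewrite invfM mulrA ler_piMl ?invr_ge0 ?(ltW s_gt0)//.
  by rewrite ler_pdivrMr ?f_gt0// mul1r pos_derive_homo.
case/andP: fxN => q0 qs.
rewrite normrM (ger0_norm q0) mulrC /C ler_pM//.
by rewrite ler_norml; apply/andP; split; lra.
Qed.

Let E_homo (x y : R) : 0 < x -> x <= y -> E x <= E y.
Proof.
move=> x0 xy; rewrite /E ler_expR lerN2 (ler_wpM2l (ltW s_gt0))// lerD2r.
have y0 : 0 < y by exact: lt_le_trans xy.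
rewrite (ler_wpM2l (ltW (f_gt0 N0)))// lef_pV2 ?posrE ?f_gt0//.
exact: pos_derive_homo.
Qed.

Let H_step j : (J <= j < N)%N -> exists2 c : R, j%:R <= c <= j.+1%:R &
  H j.+1%:R - H j%:R = H' c.
Proof.
move=> /andP[Jj jN].
have j0 : 0 < j%:R :> R by rewrite ltr0n (leq_trans J_gt0).
have [c cj E1] : exists2 c, c \in `[j%:R, j.+1%:R]%R &
    H j.+1%:R - H j%:R = H' c * (j.+1%:R - j%:R).
  apply: (@MVT_segment _ H H') => [|z|]; first by rewrite ler_nat.
    by rewrite in_itv/= => /andP[/(lt_trans j0) z0 _]; exact: dH.
  by apply: (@derive_continuous_within H H') => z /(lt_le_trans j0); exact: dH.
exists c; first by move: cj; rewrite in_itv.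
by rewrite E1 -natr1 addrAC subrr add0r mulr1.
Qed.

Let G_ge0 : 0 <= f J%:R ^+ 2 / f1 J%:R / (f N%:R * s).
Proof.
have [fJ f1J fN] : [/\ 0 < f J%:R, 0 < f1 J%:R & 0 < f N%:R].
  by split; rewrite ?f_gt0 ?f1_gt0.
by rewrite ltW// !divr_gt0 ?exprn_gt0// mulr_gt0.
Qed.

(** [E] increases, so [E j] is at most its value at the mean value point of [j, j+1], and the
    increments of [H] telescope to at most H(N) = f N/(f1 N s). The summand [J.+1] accounts for the
    indices below [J] and the index [N], whose terms are at most 1. *)
Lemma exp_sum_le : C < s ->
  \sum_(1 <= j < N.+1) expR (- (s * (f N%:R / f j%:R - 1))) <=
  J.+1%:R + f N%:R / f1 N%:R / s / (1 - C / s).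
Proof.
move=> Cs; have Cs1 : 0 < 1 - C / s by rewrite subr_gt0 ltr_pdivrMr// mul1r.
rewrite big_nat_recr/=; last exact: leq_trans JN.
rewrite divff ?gt_eqF ?f_gt0// subrr mulr0 oppr0 expR0.
rewrite (@big_cat_nat _ _ _ J)//=.
have h1 : \sum_(1 <= j < J) expR (- (s * (f N%:R / f j%:R - 1))) <= J%:R.
  apply: (@le_trans _ _ (\sum_(1 <= j < J) 1)); last first.
    by rewrite sumr_const_nat ler_nat leq_subr.
  apply: ler_sum_nat => j /andP[j1 jJ].
  have EN : E N%:R = 1.
    by rewrite /E divff ?gt_eqF ?f_gt0// subrr mulr0 oppr0 expR0.
  rewrite -[leRHS]EN.
  by apply: (@E_homo j%:R N%:R); rewrite ?ltr0n// ler_nat ltnW// (leq_trans jJ).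
have h2 : \sum_(J <= j < N) expR (- (s * (f N%:R / f j%:R - 1))) * (1 - C / s)
    <= f N%:R / f1 N%:R / s.
  apply: (@le_trans _ _ (\sum_(J <= j < N) (H j.+1%:R - H j%:R))).
    apply: ler_sum_nat => j Jj; have [c /andP[jc cj] ->] := H_step Jj.
    have [Jj1 jN] := andP Jj.
    have j0 : 0 < j%:R :> R by rewrite ltr0n (leq_trans J_gt0).
    have /andP[+ _] : E c * (1 - C / s) <= H' c <= E c * (1 + C / s).
      apply: H'_bound; first by rewrite (le_trans _ jc)// ler_nat.
      by rewrite (le_trans cj)// ler_nat.
    apply: le_trans; rewrite (ler_wpM2r (ltW Cs1))//; exact: (@E_homo j%:R c).
  rewrite (telescope_sumr (fun j => H j%:R))//.
  have HJ : 0 <= H J%:R.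
    by rewrite mulr_ge0 ?expR_ge0 ?G_ge0.
  rewrite (_ : H N%:R = f N%:R / f1 N%:R / s); first by rewrite gerBl.
  rewrite /H /E divff ?gt_eqF ?f_gt0// subrr mulr0 oppr0 expR0.
  by field; rewrite !gt_eqF// ?f_gt0// f1_gt0.
rewrite -mulr_suml -ler_pdivlMr// in h2.
by rewrite -natr1; lra.
Qed.

(** Here [E] at the mean value point is at most its value at j+1, whence a shift of index; the terms
    up to [J] are dropped, and [H J] is bounded using E(J) <= 1. *)
Lemma exp_sum_ge :
  (f N%:R / f1 N%:R / s - f J%:R ^+ 2 / f1 J%:R / (f N%:R * s)) / (1 + C / s) <=
  \sum_(1 <= j < N.+1) expR (- (s * (f N%:R / f j%:R - 1))).
Proof.
have C0 : 0 <= C.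
  by rewrite addr_ge0// (le_trans _ (f2_le (lexx J%:R))).
have Cs1 : 0 < 1 + C / s by rewrite ltr_pwDl// divr_ge0// ltW.
rewrite ler_pdivrMr// mulr_suml.
apply: (@le_trans _ _ (\sum_(J <= j < N) (H j.+1%:R - H j%:R))).
  rewrite (telescope_sumr (fun j => H j%:R))//.
  rewrite (_ : H N%:R = f N%:R / f1 N%:R / s); last first.
    rewrite /H /E divff ?gt_eqF ?f_gt0// subrr mulr0 oppr0 expR0.
    by field; rewrite !gt_eqF// ?f_gt0// f1_gt0.
  rewrite lerB// /H ler_piMl//.
  rewrite expR_le1 oppr_le0 mulr_ge0 ?(ltW s_gt0)// subr_ge0.
  rewrite ler_pdivlMr ?f_gt0// mul1r.
  by rewrite pos_derive_homo// ler_nat.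
apply: (@le_trans _ _ (\sum_(J <= j < N) expR (- (s * (f N%:R / f j.+1%:R - 1)))
  * (1 + C / s))).
  apply: ler_sum_nat => j Jj; have [c /andP[jc cj] ->] := H_step Jj.
  have [Jj1 jN] := andP Jj.
  have c0 : 0 < c by rewrite (lt_le_trans _ jc)// ltr0n (leq_trans J_gt0).
  have /andP[_] : E c * (1 - C / s) <= H' c <= E c * (1 + C / s).
    apply: H'_bound; first by rewrite (le_trans _ jc)// ler_nat.
    by rewrite (le_trans cj)// ler_nat.
  by move=> /le_trans; apply; rewrite (ler_wpM2r (ltW Cs1))//; exact: (@E_homo c
    j.+1%:R).
rewrite [leRHS](@big_cat_nat _ _ _ J.+1)//=.
rewrite [\sum_(J.+1 <= _ < _) _]big_add1/= lerDr; apply: sumr_ge0 => j _.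
by rewrite mulr_ge0 ?expR_ge0// ltW.
Qed.

End riemann_sum.

(** * Elementary bounds for Poisson probabilities and products *)

Section limits.
Context {R : realType}.

Lemma poisson_lt_ge (m : nat) (x : R) : 0 <= x ->
  expR (- x) * x ^+ m / m`!%:R <= poisson_lt m.+1 x.
Proof.
move=> x0; rewrite /poisson_lt -mulrA ler_wpM2l ?expR_ge0// big_nat_recr//=.
rewrite lerDr; apply: sumr_ge0 => k _.
by rewrite divr_ge0// exprn_ge0.
Qed.

(** Each of the [m] lower terms x^k/k! is at most x^m/x; relative to x^m/m! they add up to at most m
    m!/x. *)
Lemma poisson_lt_le (m : nat) (x : R) : 1 <= x ->
  poisson_lt m.+1 x <= expR (- x) * x ^+ m / m`!%:R * (1 + (m * m`!)%:R / x).
Proof.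
move=> x1; have x0 : 0 < x by exact: lt_le_trans x1.
have f0 : m`!%:R != 0 :> R by rewrite pnatr_eq0 -lt0n fact_gt0.
rewrite /poisson_lt -!mulrA ler_wpM2l ?expR_ge0// big_nat_recr//=.
rewrite mulrDr mulr1 addrC mulrDr lerD//.
have -> : x ^+ m * (m`!%:R^-1 * ((m * m`!)%:R / x)) = \sum_(0 <= k < m) (x ^+ m
  / x).
  rewrite sumr_const_nat subn0 natrM -[RHS]mulr_natr; field.
  by rewrite f0 gt_eqF.
apply: ler_sum_nat => k /andP[_ km].
apply: (@le_trans _ _ (x ^+ k)).
  rewrite ler_piMr ?exprn_ge0 ?(ltW x0)// invf_le1 ?ltr0n ?fact_gt0//.
  by rewrite ler1n fact_gt0.
rewrite ler_pdivlMr// -exprSr.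
by rewrite ler_weXn2l.
Qed.

Lemma cvg_ln_div (u : nat -> R) : u n @[n --> \oo] --> +oo ->
  ln (u n) / u n @[n --> \oo] --> (0 : R).
Proof.
move=> uoo; apply/cvgr0Pnorm_le => e e0; near=> n.
have u1 : 1 <= u n by near: n; exact: cvgry_ge.
(* This threshold makes 2u at most (eu)^2, while exp(l) >= 1 + l^2/2 at l = ln u gives l^2 <= 2u. *)
have ue : 2 / e ^+ 2 <= u n by near: n; exact: cvgry_ge.
have u0 : 0 < u n by exact: lt_le_trans u1.
have l0 : 0 <= ln (u n) by exact: ln_ge0.
rewrite ger0_norm ?divr_ge0 ?(ltW u0)// ler_pdivrMr//.
have := expR_ge1Dxn 1 l0; rewrite lnK ?posrE// => le2.
rewrite ler_pdivrMr ?exprn_gt0// in ue.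
rewrite -(@ler_pXn2r _ 2)// ?nnegrE ?mulr_ge0 ?(ltW e0) ?(ltW u0)//.
have {}le2 : ln (u n) ^+ 2 <= 2 * u n.
  by move: le2; rewrite (_ : 2`!%:R = 2 :> R)//; lra.
apply: (le_trans le2); rewrite exprMn.
by have := ler_wpM2l (ltW u0) ue; rewrite expr2; lra.
Unshelve. all: by end_near. Qed.

(** Factor by factor, 1 - x <= e^-x and 1/(1-x) = 1 + x/(1-x) <= e^(x/(1-eta)). *)
Lemma prod_1B_bounds (I : eqType) (r : seq I) (x : I -> R) (eta : R) :
  eta < 1 -> {in r, forall i, 0 <= x i <= eta} ->
  expR (- ((\sum_(i <- r) x i) / (1 - eta))) <= \prod_(i <- r) (1 - x i)
    <= expR (- \sum_(i <- r) x i).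
Proof.
move=> eta1 xeta; rewrite mulr_suml -!sumrN !expR_sum.
have x1 i : i \in r -> x i < 1 by move=> /xeta/andP[_ /le_lt_trans]; exact.
rewrite !big_seq; apply/andP; split; apply: ler_prod => i ir; last first.
  rewrite subr_ge0 (ltW (x1 _ ir))/=.
  by rewrite (le_trans _ (expR_ge1Dx _)).
rewrite expR_ge0/= expRN -[leRHS]invrK lef_pV2 ?posrE ?expR_gt0 ?invr_gt0
  ?subr_gt0 ?x1//.
apply: (@le_trans _ _ (1 + x i / (1 - eta))); last exact: expR_ge1Dx.
have xi1 := x1 _ ir; have /andP[x0 xe] := xeta _ ir.
rewrite -[X in X <= _](_ : 1 + x i / (1 - x i) = _); last first.
  by field; rewrite gt_eqF// subr_gt0.
rewrite lerD2l ler_wpM2l// lef_pV2 ?posrE ?subr_gt0//.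
by rewrite lerD2l lerN2.
Qed.

(** For [r] = f(N)/f(j), the factor r^m lies between 1 and e^(m(r-1)). It drops out of the lower
    bound and turns [s] into [s - m] in the upper one, so both have the form summed by [exp_sum_ge]
    and [exp_sum_le]. *)
Lemma poisson_lt_scaled_bounds (m : nat) (s r : R) : 1 <= s -> 1 <= r ->
  expR (- s) * s ^+ m / m`!%:R * expR (- (s * (r - 1))) <=
    poisson_lt m.+1 (s * r) <=
  expR (- s) * s ^+ m / m`!%:R * (1 + (m * m`!)%:R / s) *
    expR (- ((s - m%:R) * (r - 1))).
Proof.
move=> s1 r1; have s0 : 0 < s by exact: lt_le_trans s1.
have r0 : 0 < r by exact: lt_le_trans r1.
set M := expR (- s) * s ^+ m / m`!%:R.
have M0 : 0 <= M by rewrite !mulr_ge0 ?expR_ge0 ?exprn_ge0 ?(ltW s0)// invr_ge0.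
have E : expR (- (s * r)) * (s * r) ^+ m / m`!%:R =
    M * (r ^+ m * expR (- (s * (r - 1)))).
  rewrite [- _](_ : _ = - s - s * (r - 1)); last by ring.
  by rewrite expRD exprMn /M; ring.
have rm1 : 1 <= r ^+ m by rewrite exprn_ege1.
have rme : r ^+ m <= expR (m%:R * (r - 1)).
  rewrite expRM_natl lerXn2r ?nnegrE ?expR_ge0 ?(ltW r0)//.
  by rewrite (le_trans _ (expR_ge1Dx _))// addrC subrK.
apply/andP; split.
  apply: le_trans (poisson_lt_ge _ _); last by rewrite mulr_ge0// ltW.
  by rewrite E ler_wpM2l// ler_peMl// expR_ge0.
have sr1 : 1 <= s * r by rewrite mulr_ege1.
apply: le_trans (poisson_lt_le m sr1) _.
have h1 : r ^+ m * expR (- (s * (r - 1))) <= expR (- ((s - m%:R) * (r - 1))).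
  rewrite [- ((s - _) * _)](_ : _ = m%:R * (r - 1) - s * (r - 1)); last by ring.
  by rewrite expRD ler_wpM2r// expR_ge0.
have h2 : 1 + (m * m`!)%:R / (s * r) <= 1 + (m * m`!)%:R / s.
  by rewrite lerD2l ler_wpM2l// lef_pV2 ?posrE ?mulr_gt0// ler_peMr// ltW.
have h3 : 0 <= 1 + (m * m`!)%:R / (s * r).
  by rewrite addr_ge0// divr_ge0// ltW// mulr_gt0.
have h4 : 0 <= r ^+ m * expR (- (s * (r - 1))).
  by rewrite mulr_ge0 ?expR_ge0// exprn_ge0// ltW.
rewrite E -[leLHS]mulrA -[leRHS]mulrA ler_wpM2l// [leRHS]mulrC.
exact: ler_pM.
Qed.

End limits.

(** * The limit for a Poisson number of draws *)

Section poissonized_limit.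
Context {R : realType}.

Lemma cvg_invy (u : nat -> R) : u n @[n --> \oo] --> +oo ->
  (u n)^-1 @[n --> \oo] --> (0 : R).
Proof.
move=> uoo; have /gtr0_cvgV0 [_ h] : \forall n \near \oo, 0 < u n.
  exact: cvgry_gt.
exact: h.
Qed.

Lemma cvg_lny (u : nat -> R) : u n @[n --> \oo] --> +oo ->
  ln (u n) @[n --> \oo] --> +oo.
Proof.
move=> uoo; apply/cvgryPge => A; near=> n.
rewrite -[A]expRK ler_ln ?posrE ?expR_gt0//.
  by near: n; exact: cvgry_ge.
by near: n; exact: cvgry_gt.
Unshelve. all: by end_near. Qed.

Lemma cvgMy (u v : nat -> R) : u n @[n --> \oo] --> (1 : R) ->
  v n @[n --> \oo] --> +oo -> u n * v n @[n --> \oo] --> +oo.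
Proof.
move=> u1 voo; apply/cvgryPge => A; near=> n.
have un : 1 / 2 <= u n by near: n; apply: (cvgr_ge _ u1); lra.
have vn : 2 * `|A| <= v n by near: n; exact: cvgry_ge.
have A0 := normr_ge0 A; have := ler_norm A; nra.
Unshelve. all: by end_near. Qed.

Variables (f f1 f2 : R -> R) (K : R) (J : nat).
Hypothesis f_gt0 : forall x : R, 0 < x -> 0 < f x.
Hypothesis f1_gt0 : forall x : R, 0 < x -> 0 < f1 x.
Hypothesis df : forall x : R, 0 < x -> is_derive x (1 : R) f (f1 x).
Hypothesis df1 : forall x : R, 0 < x -> is_derive x (1 : R) f1 (f2 x).
Hypothesis J_gt0 : (0 < J)%N.
Hypothesis f2_le : forall x : R, J%:R <= x -> `|f2 x * f x / f1 x ^+ 2| <= K.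

Let g (N : nat) := f N%:R / f1 N%:R.
Hypothesis foo : f N%:R @[N --> \oo] --> +oo.
Hypothesis goo : g N @[N --> \oo] --> +oo.

Let S N (s : R) := \sum_(1 <= j < N.+1) expR (- (s * (f N%:R / f j%:R - 1))).

(** In the bounds on the sum multiplied by s/g, the terms from small indices vanish as s/g tends to
    0 and f, g to infinity, the relative errors as s tends to infinity. A general [s] is kept
    because the shifted time [s - m] is needed too. *)
Let S_cvg (s : nat -> R) : s N @[N --> \oo] --> +oo ->
  s N / g N @[N --> \oo] --> (0 : R) ->
  s N / g N * S N (s N) @[N --> \oo] --> (1 : R).
Proof.
move=> soo sg; have sV := cvg_invy soo; have gV := cvg_invy goo.
have fV := cvg_invy foo.
apply: (@squeeze_cvgr _ _ _ _
    (fun N => (1 - f J%:R ^+ 2 / f1 J%:R * ((f N%:R)^-1 * (g N)^-1)) / (1 + (K +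
      2) * (s N)^-1))
    (fun N => J.+1%:R * (s N / g N) + (1 - (K + 2) * (s N)^-1)^-1)).
- near=> N.
  have JN : (J <= N)%N by near: N; exact: nbhs_infty_ge.
  have s0 : 0 < s N by near: N; exact: cvgry_gt.
  have Cs : K + 2 < s N by near: N; exact: cvgry_gt.
  have g0 : 0 < g N by near: N; exact: cvgry_gt.
  have fN0 : 0 < f N%:R by near: N; exact: cvgry_gt.
  have sg0 : 0 < s N / g N by rewrite divr_gt0.
  have K0 : 0 <= K by rewrite (le_trans _ (f2_le (lexx J%:R))).
  have J0 : 0 < f1 J%:R by rewrite f1_gt0// ltr0n.
  apply/andP; split.
    have := exp_sum_ge f_gt0 f1_gt0 df df1 J_gt0 f2_le JN s0.
    move=> /(ler_wpM2l (ltW sg0)); apply: le_trans.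
    rewrite le_eqVlt; apply/orP; left; apply/eqP.
    rewrite -/(g N); field.
    have ? : 0 < s N + (K + 2) by lra.
    by rewrite !gt_eqF.
  have := exp_sum_le f_gt0 f1_gt0 df df1 J_gt0 f2_le JN s0 Cs.
  move=> /(ler_wpM2l (ltW sg0)) /le_trans; apply.
  rewrite le_eqVlt; apply/orP; left; apply/eqP.
  rewrite -/(g N); field.
  by rewrite !gt_eqF//= subr_gt0.
- rewrite [X in _ --> X](_ : 1 = (1 - f J%:R ^+ 2 / f1 J%:R * (0 * 0)) / (1 + (K
    + 2) * 0)); last first.
    by rewrite !mulr0 addr0 subr0 divr1.
  apply: cvgM.
    by apply: cvgB; [exact: cvg_cst|apply: cvgM; [exact: cvg_cst|exact: cvgM]].
  apply: cvgV; first by rewrite mulr0 addr0 oner_eq0.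
  by apply: cvgD; [exact: cvg_cst|apply: cvgM; [exact: cvg_cst|]].
- rewrite [X in _ --> X](_ : 1 = J.+1%:R * 0 + (1 - (K + 2) * 0)^-1); last first.
    by rewrite !mulr0 subr0 invr1 add0r.
  apply: cvgD; first by apply: cvgM => //; exact: cvg_cst.
  apply: cvgV; first by rewrite mulr0 subr0 oner_eq0.
  by apply: cvgB; [exact: cvg_cst|apply: cvgM; [exact: cvg_cst|]].
Unshelve. all: by end_near. Qed.

Let rh N := ln (g N).

Section fixed_time.
Variables (m : nat) (y : R).
(** Here [m] is one less than the required number of copies, so [m%:R - 1] is the coefficient
    [m%:R - 2] of [centering]. *)
Let s N := rh N + (m%:R - 1) * ln (rh N) + y.

Let rhoo : rh N @[N --> \oo] --> +oo. Proof. exact: cvg_lny. Qed.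

Let s_rh : s N / rh N @[N --> \oo] --> (1 : R).
Proof.
have lr := cvg_ln_div rhoo; have rV := cvg_invy rhoo.
have h : 1 + (m%:R - 1) * (ln (rh N) / rh N) + y * (rh N)^-1 @[N --> \oo] -->
    (1 : R).
  rewrite [X in _ --> X](_ : 1 = 1 + (m%:R - 1) * 0 + y * 0); last by ring.
  apply: cvgD; last by apply: cvgM => //; exact: cvg_cst.
  by apply: cvgD; [exact: cvg_cst|apply: cvgM => //; exact: cvg_cst].
apply: cvg_trans h; apply: near_eq_cvg; near=> N.
have r0 : 0 < rh N by near: N; exact: cvgry_gt.
by rewrite /s; field; rewrite gt_eqF.
Unshelve. all: by end_near. Qed.

Lemma time_cvgy : s N @[N --> \oo] --> +oo.
Proof.
apply: cvg_trans (cvgMy s_rh rhoo).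
apply: near_eq_cvg; near=> N.
have r0 : 0 < rh N by near: N; exact: cvgry_gt.
by rewrite divfK// gt_eqF.
Unshelve. all: by end_near. Qed.

Lemma time_ratio_cvg : s N / g N @[N --> \oo] --> (0 : R).
Proof.
have lg := cvg_ln_div goo.
have h : s N / rh N * (ln (g N) / g N) @[N --> \oo] --> (1 * 0 : R).
  exact: cvgM.
rewrite mulr0 in h.
apply: cvg_trans h; apply: near_eq_cvg; near=> N.
have r0 : 0 < rh N by near: N; exact: cvgry_gt.
have g0 : 0 < g N by near: N; exact: cvgry_gt.
by rewrite -/(rh N) /=; field; rewrite !gt_eqF.
Unshelve. all: by end_near. Qed.

(** [ratio_sublinear] gives g N <= B N, whence s/N <= B s/g. *)
Lemma time_div_cvg : s N / N%:R @[N --> \oo] --> (0 : R).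
Proof.
pose B := f J%:R / f1 J%:R + (K + 1).
have h : s N / g N * B @[N --> \oo] --> (0 * B : R).
  by apply: cvgM; [exact: time_ratio_cvg|exact: cvg_cst].
rewrite mul0r in h.
apply: (@squeeze_cvgr _ _ _ _ (fun=> 0) (fun N => s N / g N * B)) => //; last
  exact: cvg_cst.
near=> N.
have JN : (J <= N)%N by near: N; exact: nbhs_infty_ge.
have N1 : 1 <= N%:R :> R by rewrite ler1n (leq_trans J_gt0).
have N0 : 0 < N%:R :> R by exact: lt_le_trans N1.
have g0 : 0 < g N by near: N; exact: cvgry_gt.
have s0 : 0 < s N by near: N; apply: cvgry_gt; exact: time_cvgy.
rewrite divr_ge0 ?(ltW s0)//= -mulrA ler_wpM2l ?(ltW s0)//.
rewrite ler_pdivlMl// ler_pdivrMr//.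
have := ratio_sublinear f1_gt0 df df1 J_gt0 f2_le JN.
rewrite -/(g N) => /le_trans; apply.
rewrite /B [leRHS]mulrDl lerD2r ler_peMr// divr_ge0// ltW// ?f_gt0 ?f1_gt0// ltr0n.
Unshelve. all: by end_near. Qed.

Let mass N := expR (- s N) * s N ^+ m / m`!%:R.

(** As [rh] = ln g, e^-s equals e^-y rh^(1-m)/g, and the left-hand side is e^-y/m! times
    (s/rh)^(m-1). The coefficient of ln rh is chosen for this cancellation; the power is split into
    m and -1 since [m] may be 0. *)
Let mass_cvg : mass N * (g N / s N) @[N --> \oo] --> expR (- y) / m`!%:R.
Proof.
have h : expR (- y) * (s N / rh N) ^+ m * (s N / rh N)^-1 / m`!%:R @[N --> \oo] -->
    expR (- y) / m`!%:R.
  rewrite [X in _ --> X](_ : _ = expR (- y) * 1 ^+ m * 1^-1 / m`!%:R); last first.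
    by rewrite expr1n invr1 !mulr1.
  apply: cvgM; last exact: cvg_cst.
  apply: cvgM; last by apply: cvgV => //; exact: oner_neq0.
  apply: cvgM; first exact: cvg_cst.
  have := @cvg_comp _ _ _ (fun N => s N / rh N) (fun z : R => z ^+ m) _ _ _ s_rh.
  by apply; exact: exprn_continuous.
apply: cvg_trans h; apply: near_eq_cvg; near=> N.
have r0 : 0 < rh N by near: N; exact: cvgry_gt.
have g0 : 0 < g N by near: N; exact: cvgry_gt.
have s0 : 0 < s N by near: N; apply: cvgry_gt; exact: time_cvgy.
have f0 : m`!%:R != 0 :> R by rewrite pnatr_eq0 -lt0n fact_gt0.
have -> : mass N = expR (- y) * (g N)^-1 * (rh N / rh N ^+ m) * s N ^+ m / m`!%:R.
  rewrite /mass /s; congr (_ * _ / _).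
  rewrite [- _](_ : _ = - y - rh N + ln (rh N) - m%:R * ln (rh N)); last by ring.
  rewrite expRD expRD expRD !expRN expRM_natl !lnK ?posrE//.
  by rewrite !mulrA.
rewrite expr_div_n.
by field; rewrite f0 !gt_eqF// exprn_gt0.
Unshelve. all: by end_near. Qed.

Let D : R := (m * m`!)%:R.
Let x N j := poisson_lt m.+1 (s N * (f N%:R / f j%:R)).
(** An eventual bound on [x N j] uniform in [j]: the exponential factor left in the upper bound is
    at most 1 once [s] exceeds [m]. *)
Let eta N := mass N * (1 + D / s N).

Let ratio_ge1 N j : (1 <= j < N.+1)%N -> 1 <= f N%:R / f j%:R.
Proof.
move=> /andP[j1 jN]; have j0 : 0 < j%:R :> R by rewrite ltr0n.
by rewrite ler_pdivlMr ?f_gt0// mul1r (pos_derive_homo f1_gt0 df)// ler_nat.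
Qed.

Let oneV_cvg (c : R) : 1 + c / s N @[N --> \oo] --> (1 : R).
Proof.
have h : 1 + c / s N @[N --> \oo] --> (1 + c * 0 : R).
  apply: cvgD; first exact: cvg_cst.
  by apply: cvgM; [exact: cvg_cst|exact: cvg_invy time_cvgy].
by rewrite mulr0 addr0 in h.
Qed.

Let eta_cvg : eta N @[N --> \oo] --> (0 : R).
Proof.
have h : mass N * (g N / s N) * (s N / g N) * (1 + D / s N) @[N --> \oo] -->
    expR (- y) / m`!%:R * 0 * 1.
  by apply: cvgM (oneV_cvg D); apply: cvgM mass_cvg time_ratio_cvg.
rewrite mulr0 mul0r in h.
apply: cvg_trans h; apply: near_eq_cvg; near=> N.
have g0 : 0 < g N by near: N; exact: cvgry_gt.
have s0 : 0 < s N by near: N; apply: cvgry_gt; exact: time_cvgy.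
by rewrite /eta; field; rewrite !gt_eqF.
Unshelve. all: by end_near. Qed.

(** Squeezed between the limits of [S_cvg] at [s] and at [s - m], as s/(s-m) tends to 1. *)
Let sum_cvg :
  \sum_(1 <= j < N.+1) x N j @[N --> \oo] --> expR (- y) / m`!%:R.
Proof.
have soo := time_cvgy; have sg := time_ratio_cvg; have sV := cvg_invy soo.
have smoo : s N - m%:R @[N --> \oo] --> +oo.
  apply/cvgryPge => A; near=> N; rewrite lerBrDr.
  by near: N; exact: cvgry_ge.
have smg : (s N - m%:R) / g N @[N --> \oo] --> (0 : R).
  have h : s N / g N - m%:R * (g N)^-1 @[N --> \oo] --> (0 - m%:R * 0 : R).
    by apply: cvgB => //; apply: cvgM; [exact: cvg_cst|exact: cvg_invy].
  rewrite mulr0 subr0 in h.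
  by under eq_cvg do rewrite mulrBl.
have s1V : (1 + (- m%:R) / s N)^-1 @[N --> \oo] --> (1 : R).
  by rewrite -[X in _ --> X]invr1; apply: cvgV; rewrite ?oner_neq0.
apply: (@squeeze_cvgr _ _ _ _
  (fun N => mass N * (g N / s N) * (s N / g N * S N (s N)))
  (fun N => mass N * (g N / s N) * (1 + D / s N) * (1 + (- m%:R) / s N)^-1 *
     ((s N - m%:R) / g N * S N (s N - m%:R)))).
- near=> N.
  have g0 : 0 < g N by near: N; exact: cvgry_gt.
  have s1 : 1 <= s N by near: N; exact: cvgry_ge.
  have sm : m%:R < s N by near: N; exact: cvgry_gt.
  have s0 : 0 < s N by exact: lt_le_trans s1.
  apply/andP; split.
    rewrite [leLHS](_ : _ = mass N * S N (s N)); last first.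
      by field; rewrite !gt_eqF.
    rewrite mulr_sumr; apply: ler_sum_nat => j /ratio_ge1 r1.
    by have /andP[] := poisson_lt_scaled_bounds m s1 r1.
  rewrite [leRHS](_ : _ = eta N * S N (s N - m%:R)); last first.
    by rewrite /eta; field; rewrite !gt_eqF// subr_gt0.
  rewrite mulr_sumr; apply: ler_sum_nat => j /ratio_ge1 r1.
  by have /andP[] := poisson_lt_scaled_bounds m s1 r1.
- rewrite -[X in _ --> X]mulr1.
  exact: cvgM mass_cvg (S_cvg soo sg).
- rewrite [X in _ --> X](_ : _ = expR (- y) / m`!%:R * 1 * 1 * 1); last by
    rewrite !mulr1.
  by apply: cvgM (S_cvg smoo smg); apply: cvgM s1V; apply: cvgM mass_cvg
    (oneV_cvg D).
Unshelve. all: by end_near. Qed.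

(** Since [eta] tends to 0, the two exponential bounds of [prod_1B_bounds] have the same limit. *)
Lemma poissonized_cvg :
  \prod_(1 <= j < N.+1) (1 - poisson_lt m.+1 (s N * (f N%:R / f j%:R)))
    @[N --> \oo] --> expR (- (expR (- y) / m`!%:R)).
Proof.
have expc (u : nat -> R) (l : R) : u N @[N --> \oo] --> l ->
    expR (u N) @[N --> \oo] --> expR l.
  by move=> ul; apply: (cvg_comp u (@expR R) ul); exact: continuous_expR.
apply: (@squeeze_cvgr _ _ _ _
  (fun N => expR (- ((\sum_(1 <= j < N.+1) x N j) / (1 - eta N))))
  (fun N => expR (- \sum_(1 <= j < N.+1) x N j))).
- near=> N.
  have s1 : 1 <= s N by near: N; apply: cvgry_ge; exact: time_cvgy.
  have sm : m%:R < s N by near: N; apply: cvgry_gt; exact: time_cvgy.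
  have e1 : eta N < 1 by near: N; apply: (cvgr_lt _ eta_cvg); exact: ltr01.
  have s0 : 0 < s N by exact: lt_le_trans s1.
  have mass0 : 0 <= mass N.
    by rewrite !mulr_ge0 ?expR_ge0 ?exprn_ge0 ?(ltW s0)// invr_ge0.
  have eta0 : 0 <= eta N.
    by rewrite mulr_ge0// addr_ge0// divr_ge0// ltW.
  apply: prod_1B_bounds e1 _ => j.
  rewrite mem_index_iota => /ratio_ge1 r1.
  have /andP[h1 h2] := poisson_lt_scaled_bounds m s1 r1.
  apply/andP; split.
    by apply: le_trans h1; rewrite mulr_ge0// expR_ge0.
  apply: (le_trans h2); rewrite ler_piMr// expR_le1 oppr_le0.
  by rewrite mulr_ge0// subr_ge0// ltW.
- apply: expc; apply: cvgN.
  rewrite -[X in _ --> X]divr1; apply: cvgM => //.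
  apply: cvgV; first exact: oner_neq0.
  have h : 1 - eta N @[N --> \oo] --> (1 - 0 : R) by apply: cvgB => //; exact:
    cvg_cst.
  by rewrite subr0 in h.
- by apply: expc; exact: cvgN.
Unshelve. all: by end_near. Qed.

End fixed_time.

(** * Return to a deterministic number of draws *)

Let time (m : nat) (y : R) N := rh N + (m%:R - 1) * ln (rh N) + y.

(** Replacing [y] by y + a or y - a moves the Poisson parameter by [a * k N]. The Chebyshev error is
    then time/(a^2 k), which tends to 0 because [k N] is at least [N]; continuity of the limit in
    [y] closes the gap. *)
Lemma cover_prob_cvg (m : nat) (y : R) (p : nat -> nat -> R) (k : nat -> R) :
  (forall N j, 0 <= p N j) ->
  (\forall N \near \oo, [/\ \sum_(1 <= j < N.+1) p N j = 1, N%:R <= k N &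
    forall j, (1 <= j < N.+1)%N -> p N j * k N = f N%:R / f j%:R]) ->
  cover_prob (p N) N (Num.truncn (k N * time m y N)) (fun=> m.+1)
    @[N --> \oo] --> expR (- (expR (- y) / m`!%:R)).
Proof.
move=> p0 pk; pose F (z : R) := expR (- (expR (- z) / m`!%:R)).
have Fc : {for y, continuous F}.
  apply: (@continuous_comp _ _ _ (fun z : R => - (expR (- z) / m`!%:R)) expR);
    last exact: continuous_expR.
  apply: continuousN; apply: continuousM; last exact: cst_continuous.
  apply: (@continuous_comp _ _ _ -%R expR); last exact: continuous_expR.
  exact: opp_continuous.
apply/cvgrPdist_lt => e e0.
have e2 : 0 < e / 2 by rewrite divr_gt0.
have /nbhs_ballP[r /= r0 rF] : \forall z \near y, `|F y - F z| < e / 2.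
  by move: Fc => /cvgrPdist_lt/(_ _ e2).
(* Half the radius keeps both shifted points inside the ball. Of the error, e/2 goes to continuity,
   e/4 to the product limit and e/4 to Chebyshev. *)
pose a := r / 2; have a0 : 0 < a by rewrite divr_gt0.
have ball_dist z : `|y - z| < r -> `|F y - F z| < e / 2 by move=> h; exact: rF.
have Fp : `|F y - F (y + a)| < e / 2.
  apply: ball_dist; rewrite opprD addrA subrr add0r normrN gtr0_norm// /a; lra.
have Fm : `|F y - F (y - a)| < e / 2.
  apply: ball_dist; rewrite opprB addrCA subrr addr0 gtr0_norm// /a; lra.
have tail z : (time m z N / N%:R) / a ^+ 2 @[N --> \oo] --> (0 : R).
  have h : (time m z N / N%:R) / a ^+ 2 @[N --> \oo] --> (0 / a ^+ 2 : R).
    by apply: cvgM; [exact: time_div_cvg|exact: cvg_cst].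
  by rewrite mul0r in h.
have e4 : 0 < e / 4 by rewrite divr_gt0.
have tl z : \forall N \near \oo, `|time m z N / N%:R / a ^+ 2| < e / 4.
  by have /cvgr0Pnorm_lt/(_ _ e4) := tail z.
have li z : \forall N \near \oo, `|F z - \prod_(1 <= j < N.+1)
    (1 - poisson_lt m.+1 (time m z N * (f N%:R / f j%:R)))| < e / 4.
  by have /cvgrPdist_lt/(_ _ e4) := @poissonized_cvg m z.
near=> N.
have [p1 Nk pf] : [/\ \sum_(1 <= j < N.+1) p N j = 1, N%:R <= k N &
    forall j, (1 <= j < N.+1)%N -> p N j * k N = f N%:R / f j%:R] by near: N.
have N0 : 0 < N%:R :> R by rewrite ltr0n; near: N; exact: nbhs_infty_gt.
have k0 : 0 < k N by exact: lt_le_trans Nk.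
have tp0 : 0 < time m (y + a) N by near: N; apply: cvgry_gt; exact: time_cvgy.
have tm0 : 0 < time m (y - a) N by near: N; apply: cvgry_gt; exact: time_cvgy.
have tpE : time m (y + a) N = time m y N + a by rewrite /time; ring.
have tmE : time m (y - a) N = time m y N - a by rewrite /time; ring.
set c := cover_prob _ _ _ _.
have ka0 : 0 < a * k N by rewrite mulr_gt0.
have prodE z : \prod_(1 <= j < N.+1) (1 - poisson_lt m.+1 (p N j * (k N * time m
  z N))) =
    \prod_(1 <= j < N.+1) (1 - poisson_lt m.+1 (time m z N * (f N%:R / f j%:R))).
  by apply: eq_big_nat => j jN; rewrite mulrA pf// [time m z N * _]mulrC.
have tailE z : 0 < time m z N ->
    k N * time m z N / (a * k N) ^+ 2 <= time m z N / N%:R / a ^+ 2.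
  move=> tz; rewrite (_ : k N * _ / _ = time m z N / k N / a ^+ 2); last first.
    by field; rewrite !gt_eqF.
  by rewrite ler_wpM2r ?invr_ge0 ?sqr_ge0// ler_wpM2l ?(ltW tz)// lef_pV2 ?posrE.
have c1 : c <= 1 by exact: cover_prob_le1.
have c0 : 0 <= c by exact: cover_prob_ge0.
have up : c * (1 - k N * time m (y + a) N / (a * k N) ^+ 2) <=
    \prod_(1 <= j < N.+1) (1 - poisson_lt m.+1 (time m (y + a) N * (f N%:R / f
      j%:R))).
  rewrite -prodE; apply: cover_prob_le_poisson => //.
    by rewrite mulr_ge0 ?ltW.
  rewrite tpE [k N * (time m y N + a)]mulrDr [a * k N]mulrC addrK truncn_le.
  by rewrite mulr_ge0 ?(ltW k0)// ltW// (lt_trans a0)// -subr_gt0 -tmE.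
have lo : \prod_(1 <= j < N.+1) (1 - poisson_lt m.+1 (time m (y - a) N * (f N%:R
  / f j%:R)))
    <= c + k N * time m (y - a) N / (a * k N) ^+ 2.
  rewrite -prodE; apply: poisson_le_cover_prob => //.
    by rewrite mulr_ge0 ?ltW.
  by rewrite tmE [k N * (time m y N - a)]mulrBr [a * k N]mulrC subrK ltW//
    truncnS_gt.
have tlp : `|time m (y + a) N / N%:R / a ^+ 2| < e / 4 by near: N.
have tlm : `|time m (y - a) N / N%:R / a ^+ 2| < e / 4 by near: N.
have lip : `|F (y + a) - \prod_(1 <= j < N.+1) (1 - poisson_lt m.+1
    (time m (y + a) N * (f N%:R / f j%:R)))| < e / 4 by near: N.
have lim : `|F (y - a) - \prod_(1 <= j < N.+1) (1 - poisson_lt m.+1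
    (time m (y - a) N * (f N%:R / f j%:R)))| < e / 4 by near: N.
have u1v1 := tailE _ tp0; have u2v2 := tailE _ tm0.
have u10 : 0 <= k N * time m (y + a) N / (a * k N) ^+ 2.
  by rewrite divr_ge0 ?sqr_ge0// mulr_ge0 ?(ltW k0)// ltW.
rewrite -/(F y).
clearbody c; clear -up lo tlp tlm lip lim Fp Fm u1v1 u2v2 u10 c0 c1.
move: up lo tlp tlm lip lim Fp Fm u1v1 u2v2 u10 c0 c1.
move: (F y) (F (y + a)) (F (y - a)) c => A B D c.
move: (k N * _ / _) (k N * _ / _) => u2 u1.
move: (\prod_(_ <= _ < _) _) (\prod_(_ <= _ < _) _) => P1 P2.
move: (time _ _ _ / _ / _) (time _ _ _ / _ / _) => v1 v2.
rewrite !ltr_norml => up lo /andP[_ v1e] /andP[_ v2e].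
move=> /andP[? ?] /andP[? ?] /andP[? ?] /andP[? ?] ? ? u10 c0 c1.
(* The only nonlinear term, removed by [c <= 1]. *)
have cu : c * u1 <= u1 by rewrite ler_piMl.
apply/andP; split; lra.
Unshelve. all: by end_near. Qed.

End poissonized_limit.

(** * The limit law of the normalised collection time *)

Theorem theorem4p2 (R : realType) (m : nat) (hm : (0 < m)%N) (f : R -> R)
    (f_C3 : Ck_on 3 `]0, +oo[ f)
    (f_gt0 : forall x : R, 0 < x -> 0 < f x)
    (df_gt0 : forall x : R, 0 < x -> 0 < f^`()%classic x)
    (f_i : f x @[x --> +oo] --> +oo)
    (f_ii : f^`()%classic x / f x @[x --> +oo] --> (0 : R))
    (f_iii : (fun x : R => (f^`(2)%classic x / f^`()%classic x) / (f^`()%classic x / f x))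
               =O_ (pinfty_nbhs R) (fun=> 1 : R))
    (f_iv : (fun x : R => f^`(3)%classic x * f x ^+ 2 / f^`()%classic x ^+ 3)
              =O_ (pinfty_nbhs R) (fun=> 1 : R))
    (d : nat -> measure_display) (Omega : forall N, measurableType (d N))
    (P : forall N, probability (Omega N) R)
    (X : forall N, nat -> {RV (P N) >-> nat})
    (X_draws : forall N : nat, (0 < N)%N ->
       coupon_draws N (coupon_prob f N) (X N))
    (y : R) :
  P N [set w : Omega N |
        ((collection_time R m N (fun i => X N i w) - (centering f m N)%:E)
           * ((scaling f N)^-1)%:E <= y%:E)%E] @[N --> \oo] -->
    (expR (- (expR (- y) / (m.-1)`!%:R)))%:E.
Proof.
case: m hm => // m _.
pose f1 : R -> R := f^`()%classic; pose f2 : R -> R := f^`(2)%classic.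
have dfi i (x : R) : (i < 3)%N -> 0 < x ->
    is_derive x (1 : R) (f^`(i)%classic) (f^`(i.+1)%classic x).
  move=> i3 x0; rewrite derive1nS derive1E; apply/derivableP.
  by case: f_C3 => + _; apply => //=; rewrite in_itv/= x0.
have df (x : R) : 0 < x -> is_derive x (1 : R) f (f1 x) by exact: (dfi 0%N).
have df1 (x : R) : 0 < x -> is_derive x (1 : R) f1 (f2 x) by exact: (dfi 1%N).
have f10 (x : R) : 0 < x -> 0 < f1 x by exact: df_gt0.
have [K [J [J0 f2K]]] : exists K, exists J, (0 < J)%N /\
    forall x : R, J%:R <= x -> `|f2 x * f x / f1 x ^+ 2| <= K.
  move/eqOP: f_iii => [K [_ hK]].
  (* The O(1) condition gives every bound above its constant, here [K + 1], beyond some [M]; [J] is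
     then a positive integer above [M]. *)
  have {hK} [M [_ hM]] := hK (K + 1) ltac:(lra).
  exists (K + 1), (Num.truncn M).+1; split => // x Mx.
  have x0 : 0 < x by rewrite (lt_le_trans _ Mx)// ltr0n.
  have := hM x (lt_le_trans (truncnS_gt M) Mx).
  rewrite /= normr1 mulr1; apply: le_trans.
  rewrite le_eqVlt; apply/orP; left; apply/eqP; congr (`|_|).
  change (f2 x * f x / f1 x ^+ 2 = f2 x / f1 x / (f1 x / f x)); field.
  by rewrite !gt_eqF ?f_gt0 ?f10.
have foo : f N%:R @[N --> \oo] --> +oo by exact: cvg_comp cvgr_idn f_i.
have goo : f N%:R / f1 N%:R @[N --> \oo] --> +oo.
  have h : f1 N%:R / f N%:R @[N --> \oo] --> (0 : R) by exact: cvg_comp cvgr_idn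
    f_ii.
  have /cvgrVy [_ /(_ h)] : \forall N \near \oo, 0 < f1 N%:R / f N%:R.
    near=> N; have N0 : 0 < N%:R :> R by rewrite ltr0n; near: N; exact:
      nbhs_infty_gt.
    by rewrite divr_gt0 ?f_gt0 ?f10.
  apply: cvg_trans; apply: near_eq_cvg; near=> N.
  by rewrite /= invf_div.
(* The value at 0 is reset because f(0) may be negative, whereas the covering lemmas ask for
   nonnegative [p] at every index. *)
pose p N j := if (0 < j)%N then coupon_prob f N j else 0.
have w0 j : (0 < j)%N -> 0 < weight f j by move=> j0; rewrite invr_gt0 f_gt0//
  ltr0n.
have A0 N : (0 < N)%N -> 0 < weight_sum f N.
  move=> N0; rewrite /weight_sum big_nat_recr//= ltr_wpDl ?w0//.
  by rewrite big_nat_cond; apply: sumr_ge0 => j /andP[/andP[j0 _] _]; exact: ltW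
    (w0 _ j0).
have p0 N j : 0 <= p N j.
  rewrite /p; case: ifP => // j0; rewrite divr_ge0 ?(ltW (w0 _ j0))//.
  by rewrite /weight_sum big_nat_cond; apply: sumr_ge0 => i /andP[/andP[i0 _]
    _]; exact: ltW (w0 _ i0).
have pE N j : (1 <= j < N.+1)%N -> p N j = coupon_prob f N j by rewrite /p =>
  /andP[->].
have p1 N : (0 < N)%N -> \sum_(1 <= j < N.+1) p N j = 1.
  move=> N0; rewrite (eq_big_nat _ _ (pE N)) -mulr_suml divff// gt_eqF//.
  exact: A0.
have k0 N : (0 < N)%N -> 0 < scaling f N.
  by move=> N0; rewrite mulr_gt0 ?A0 ?f_gt0// ltr0n.
(* A_N f(N) is the sum of the N ratios f(N)/f(j), each at least 1. *)
have kN N : (0 < N)%N -> N%:R <= scaling f N.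
  move=> N0; rewrite /scaling /weight_sum mulr_suml.
  rewrite [leLHS](_ : _ = \sum_(1 <= j < N.+1) 1); last first.
    by rewrite sumr_const_nat subn1.
  apply: ler_sum_nat => j /andP[j1 jN].
  have j0 : 0 < j%:R :> R by rewrite ltr0n.
  rewrite mulrC ler_pdivlMr ?f_gt0// mul1r.
  by rewrite (pos_derive_homo f10 df)// ler_nat.
have pk N j : (1 <= j < N.+1)%N -> p N j * scaling f N = f N%:R / f j%:R.
  move=> jN; have /andP[j1 jN'] := jN; rewrite pE//.
  have AN : 0 < weight_sum f N by rewrite A0// (leq_trans j1).
  rewrite /coupon_prob /scaling /weight; field.
  by rewrite !gt_eqF ?f_gt0 ?ltr0n.
pose time N := ln (f N%:R / f1 N%:R) + (m%:R - 1) * ln (ln (f N%:R / f1 N%:R)) + y.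
have cvgc : cover_prob (p N) N (Num.truncn (scaling f N * time N)) (fun=> m.+1)
    @[N --> \oo] --> expR (- (expR (- y) / m`!%:R)).
  apply: (cover_prob_cvg f_gt0 f10 df df1 J0 f2K foo goo) => //.
  near=> N; have N0 : (0 < N)%N by near: N; exact: nbhs_infty_gt.
  by split; [exact: p1|exact: kN|exact: pk].
have timeoo := time_cvgy goo m y.
have {}cvgc : (cover_prob (p N) N (Num.truncn (scaling f N * time N)) (fun=>
  m.+1))%:E
    @[N --> \oo] --> (expR (- (expR (- y) / m`!%:R)))%:E.
  by apply: cvg_EFin => //; near=> N.
apply: cvg_trans cvgc; apply: near_eq_cvg; near=> N.
have N0 : (0 < N)%N by near: N; exact: nbhs_infty_gt.
have t0 : 0 < time N by near: N; exact: cvgry_gt.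
have Xp : coupon_draws N (p N) (X N).
  have [XI XD] := X_draws _ N0; split => // i j jN.
  by rewrite XD// pE.
rewrite -(coupon_cover_prob _ _ Xp (p1 _ N0)); congr (P N _).
(* The event bounds the collection time by b_N + y k_N, which is the real number whose integer part
   appears in [cvgc]. *)
have tE : centering f m.+1 N + y * scaling f N = scaling f N * time N.
  by rewrite /centering -/(scaling f N) /rho /time -/f1 -natr1; ring.
apply/seteqP; split => w /=.
  move=> /(collection_time_le m.+1 N (fun i => X N i w) (mulr_ge0 (ltW (k0 _
    N0)) (ltW t0))).2.
  by rewrite -tE lee_pdivrMr ?k0// EFinN leeBlDr// -EFinM -EFinD addrC.
rewrite lee_pdivrMr ?k0// EFinN leeBlDr// -EFinM -EFinD addrC tE => h.
by apply/collection_time_le => //; rewrite mulr_ge0 ?(ltW (k0 _ N0)) ?ltW.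
Unshelve. all: by end_near. Qed.
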